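(* Let $1<p\le\infty$ and let $f:\mathbb{T}^{\infty}\to\mathbb{R}$ be a measurable function that is Lipschitz with respect to the metric $\mathrm{dist}_p$. Then there exists $a\in\mathbb{R}$ with the following property: for every $\varepsilon>0$ there exists a parallel infinite-dimensional subtorus $M\subseteq\mathbb{T}^{\infty}$ such that $\|f-a\|_{L^{\infty}(M)}<\varepsilon$.
   Context: $\mathbb{T}=\mathbb{R}/\mathbb{Z}$ and $\mathbb{T}^{\infty}=\mathbb{T}^{\mathbb{N}}$ is the set of sequences $x=(x_i)_{i\ge1}$ with $x_i\in\mathbb{T}$. Let $\sigma$ be the uniform probability measure on $\mathbb{T}^{\infty}$ (the complete product of Haar probability measures on the circle); ''measurable'' refers to $\sigma$. For $x,y\in\mathbb{T}^\infty$, $\mathrm{dist}_p(x,y)=\left(\sum_{i\ge1}\mathrm{dist}^p(x_i,y_i)\right)^{1/p}$ and $\mathrm{dist}_\infty(x,y)=\sup_i \mathrm{dist}(x_i,y_i)$, where $\mathrm{dist}(x_i,y_i)$ is the distance in the circle $\mathbb{R}/\mathbb{Z}$; these may equal $+\infty$. A parallel infinite-dimensional subtorus is a set $M=\{x\in\mathbb{T}^\infty:\ x_i=b_i \text{ for all } i\in\mathbb{N}\setminus A\}$ for some infinite $A\subseteq\mathbb{N}$ and some $b:\mathbb{N}\setminus A\to\mathbb{T}$; $M$ carries its uniform (product) probability measure, with respect to which $L^\infty(M)$ is taken. *)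

(* Defs.v *)
From HB Require Import structures.
From mathcomp Require Import all_boot all_order all_algebra.
From mathcomp Require Import all_classical all_reals all_analysis.
From mathcomp Require Import ess_sup_inf.
Set Implicit Arguments. Unset Strict Implicit. Unset Printing Implicit Defensive.
Import Order.TTheory GRing.Theory Num.Theory.
Import numFieldTopology.Exports numFieldNormedType.Exports.
Local Open Scope classical_set_scope.
Local Open Scope ring_scope.

(* The circle T = R/Z is represented by R (points of T^oo are real sequences,
   considered modulo 1 in each coordinate).  Distance on the circle:
   distance from x - y to the nearest integer. *)
Definition cdist {R : realType} (x y : R) : R :=
  let t := x - y - (Num.floor (x - y))%:~R in Num.min t (1 - t).

Definition dist_p {R : realType} (p : \bar R) (x y : nat -> R) : \bar R :=
  match p with
  | +oo%E => ereal_sup (range (fun i => (cdist (x i) (y i))%:E))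
  | r%:E => ((\sum_(0 <= i <oo) ((cdist (x i) (y i)) `^ r)%:E) `^ r^-1)%E
  | -oo%E => +oo%E (* unused: p > 1 *)
  end.

Definition coord_sets (R : realType) : set (set (nat -> R)) :=
  [set S | exists (i : nat) (B : set R), measurable B /\ S = (fun x => x i) @^-1` B].

Notation Tinf R := (g_sigma_algebraType (@coord_sets R)).

(* P is the uniform (Haar product) probability on T^oo, identified with
   [0,1)^N: its value on every finite-dimensional box is the product of
   the side lengths.  This determines P uniquely on the product sigma-algebra. *)
Definition is_uniform_product {R : realType} (P : probability (Tinf R) R) : Prop :=
  forall (n : nat) (a b : nat -> R),
    (forall i, (i < n)%N -> 0 <= a i <= b i /\ b i <= 1) ->
    P [set x : Tinf R | forall i, (i < n)%N -> a i <= x i < b i]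
      = (\prod_(i < n) (b i - a i))%:E.

Definition completion_measurable_set {R : realType} (P : probability (Tinf R) R)
    (A : set (Tinf R)) : Prop :=
  exists B : set (Tinf R), measurable B /\
    (P : set (Tinf R) -> \bar R).-negligible ((A `\` B) `|` (B `\` A)).

Definition completion_measurable_fun {R : realType} (P : probability (Tinf R) R)
    (f : Tinf R -> R) : Prop :=
  forall Y : set R, measurable Y -> completion_measurable_set P (f @^-1` Y).

(* The parametrisation of the parallel subtorus
   M = {x | x_i = b_i for i not in A}: coordinates in A are free. The uniform
   measure on M is the push-forward of P by this map. *)
Definition subtorus_param {R : realType} (A : set nat) (b : nat -> R)
    (x : nat -> R) : nat -> R :=
  fun i => if `[< A i >] then x i else b i.

(* Main.v *)
Require Import Defs.
From HB Require Import structures.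
From mathcomp Require Import all_boot all_order all_algebra.
From mathcomp Require Import all_classical all_reals all_analysis.
From mathcomp Require Import ess_sup_inf measurable_realfun.
From mathcomp Require Import ring lra.
Set Implicit Arguments. Unset Strict Implicit. Unset Printing Implicit Defensive.
Import Order.TTheory GRing.Theory Num.Theory.
Import numFieldTopology.Exports numFieldNormedType.Exports.
Local Open Scope classical_set_scope.
Local Open Scope ring_scope.

(* Resampling: replacing the coordinates of a random point z in a set A by those
   of an independent copy x preserves P.  A measurable function is approximated
   in measure by functions of finitely many coordinates, so the values
   f(resample A) and f(resample B) are close in measure once A and B agree far
   enough;
   in particular resampling one more, sufficiently late, coordinate changes f by
   at most d off a set of tiny probability.  Since f is Lipschitz in every finite
   set of coordinates and boxes have a probability bounded below, Fubini upgrades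
   this to: for most z, changing that coordinate moves f by at most d
   simultaneously for ALL values of the previously chosen coordinates.  Choosing
   coordinates A = {i_0 < i_1 < ...} inductively with summable d's, for most z
   every finite modification of z inside A moves f by at most eps, and, by
   approximation in measure again, so does almost every infinite modification.
   Fixing such a z with |f z| <= K, K independent of eps, gives a subtorus on
   which f is within eps of f z, and a is a cluster point of these values.
   The metric dist_p enters only through points differing in one coordinate,
   where it is the circle distance for every p. *)

(** * Circle distance and changes of finitely many coordinates *)

Section circle.
Context {R : realType}.
Implicit Types (x y : R) (u v : nat -> R).

Lemma cdist_ge0 x y : 0 <= cdist x y.
Proof.
rewrite /cdist /= le_min; have /andP[] := mem_rg1_floor (x - y); lra.
Qed.

Lemma cdistxx x : cdist x x = 0.
Proof. by rewrite /cdist subrr floor0 subrr subr0 min_l. Qed.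

(** Integers up to the floor of [x - y] are at least the fractional part away; later ones are at
    least its complement to 1 away. *)
Lemma cdist_le_shift x y (m : int) : cdist x y <= `|x - y - m%:~R|.
Proof.
rewrite /cdist /=; set k := Num.floor (x - y).
have /andP[k0 k1] : k%:~R <= x - y < k%:~R + 1 by exact: mem_rg1_floor.
rewrite ge_min.
have [mk|km] := leP m k.
  have : m%:~R <= k%:~R :> R by rewrite ler_int.
  by move=> ?; rewrite ger0_norm; [apply/orP; left; lra|lra].
have : (k + 1)%:~R <= m%:~R :> R by rewrite ler_int lezD1.
by rewrite intrD => ?; rewrite ler0_norm; [apply/orP; right; lra|lra].
Qed.

(** [is_uniform_product] speaks of boxes inside the unit cube, so a neighbourhood of x modulo 1 has
    to be found inside [0,1]. The interval starts at the fractional part of x, or at [1 - r] if it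
    would overrun 1; either way it contains that fractional part. *)
Lemma cdist_itv (r x : R) : 0 < r -> r <= 1 ->
  exists2 a, 0 <= a <= 1 - r & forall y, a <= y < a + r -> cdist x y <= r.
Proof.
move=> r0 r1; set k := Num.floor x.
have /andP[k0 k1] : k%:~R <= x < k%:~R + 1 by exact: mem_rg1_floor.
exists (Num.min (x - k%:~R) (1 - r)).
  by rewrite le_min ge_min lexx orbT; apply/andP; split => //; lra.
move=> y /andP[]; case: (leP (x - k%:~R) (1 - r)) => ? ? ?;
  apply: (le_trans (cdist_le_shift _ _ k)); rewrite ler_norml; lra.
Qed.

(** For finite p only the i-th term of the series can be nonzero, and the outer root undoes its
    power. *)
Lemma dist_p_single (p : \bar R) (i : nat) u v : (1%:E < p)%E ->
  (forall j, j != i -> u j = v j) ->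
  (dist_p p u v <= (cdist (u i) (v i))%:E)%E.
Proof.
move=> p1 uv.
have cj0 j : j != i -> cdist (u j) (v j) = 0 by move=> /uv ->; exact: cdistxx.
case: p p1 => [r| |] //=; rewrite ?lte_fin => r1; last first.
  apply: ge_ereal_sup => _ [j _ <-]; rewrite lee_fin.
  by have [->//|/cj0 ->] := eqVneq j i; exact: cdist_ge0.
have r0 : r != 0 by lra.
set c := cdist (u i) (v i).
have c0 : 0 <= c := cdist_ge0 _ _.
have -> : c%:E = ((c `^ r)%:E `^ r^-1)%E.
  by rewrite poweR_EFin -powRrM mulfV// powRr1.
have s0 : (0 <= \sum_(0 <= j <oo) (cdist (u j) (v j) `^ r)%:E)%E.
  by apply: nneseries_ge0 => j _ _; rewrite lee_fin powR_ge0.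
apply: gt0_ler_poweR => //.
- by rewrite invr_ge0; lra.
- by rewrite in_itv /= s0 leey.
- by rewrite in_itv /= lee_fin powR_ge0 leey.
apply: lime_le.
  by apply: is_cvg_nneseries => j _ _; rewrite lee_fin powR_ge0.
apply: nearW => n; rewrite /= big_mkord.
have [ni|ni] := leqP n i.
  rewrite big1 ?lee_fin ?powR_ge0// => j _.
  by rewrite cj0 ?powR0// neq_ltn (leq_trans (ltn_ord j) ni).
rewrite (bigD1 (Ordinal ni))//= big1 ?adde0// => j ji.
by rewrite cj0 ?powR0.
Qed.

(** The coordinates in [s] are changed one at a time, each at cost at most [L * r] whatever p is;
    the triangle inequality is applied to the values of f. *)
Lemma lipschitz_finite_change (p : \bar R) (f : (nat -> R) -> R) (L r : R)
    (s : seq nat) u v :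
  (1%:E < p)%E -> 0 <= L -> 0 <= r ->
  (forall x y : nat -> R, (`|f x - f y|%:E <= L%:E * dist_p p x y)%E) ->
  (forall j, j \in s -> cdist (u j) (v j) <= r) ->
  (forall j, j \notin s -> u j = v j) ->
  `|f u - f v| <= L * r * (size s)%:R.
Proof.
move=> p1 L0 r0 fL; elim: s u => [|i s IHs] u us uns.
  have -> : u = v by apply/funext => j; exact: uns.
  by rewrite subrr normr0 mulr0.
pose w j := if j == i then v j else u j.
have fuw : `|f u - f w| <= L * r.
  rewrite -lee_fin (le_trans (fL _ _))// EFinM lee_wpmul2l ?lee_fin//.
  apply: (le_trans (@dist_p_single p i u w p1 _)) => [j /negbTE ji|].
    by rewrite /w ji.
  by rewrite lee_fin /w eqxx us// mem_head.
have fwv : `|f w - f v| <= L * r * (size s)%:R.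
  apply: IHs => j js; rewrite /w; case: eqP => [//|/eqP ji].
  - by rewrite cdistxx.
  - by rewrite us// inE js orbT.
  - by rewrite uns// inE negb_or ji.
rewrite /= -natr1 mulrDr mulr1 [X in _ <= X]addrC.
by rewrite (le_trans (ler_distD (f w) _ _))// lerD.
Qed.

End circle.

(** * Resampling preserves the uniform product measure *)

Section resampling.
Context {R : realType}.
Local Notation T := (Tinf R).
Implicit Types (A B : set nat) (b : nat -> \bar R) (n : nat).

(** The first component is the base point z and the second the fresh copy: with z fixed, this
    parametrises a parallel subtorus, so sections over z describe f on subtori. *)
Definition resample A (zx : T * T) : T := subtorus_param A zx.1 zx.2.

Lemma measurable_coord (i : nat) :
  measurable_fun setT (fun x : T => (x : nat -> R) i).
Proof.
move=> _ Y mY; rewrite setTI; apply: sub_sigma_algebra.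
by exists i, Y.
Qed.

Lemma measurable_box n (lo hi : nat -> R) :
  measurable [set x : T | forall i, (i < n)%N -> lo i <= (x : nat -> R) i < hi i].
Proof.
rewrite [X in measurable X](_ : _ =
    \bigcap_(i < n) ((fun x : T => (x : nat -> R) i) @^-1` `[lo i, hi i[)).
  apply: bigcap_measurableType => i _; rewrite -[X in measurable X]setTI.
  exact: measurable_coord.
by apply/seteqP; split => x xb i /= ni; have := xb i ni; rewrite /= in_itv.
Qed.

Lemma measurable_resample A : measurable_fun setT (resample A).
Proof.
apply: (@measurability _ _ _ T _ _ (@coord_sets R)) => // _ [_ [i [B [mB ->]]] <-].
rewrite setTI; case: (asboolP (A i)) => Ai.
- have := measurableT_comp (measurable_coord i)
    (@measurable_snd _ _ T T) measurableT mB.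
  rewrite setTI; congr (measurable _); apply/funext => -[z x] /=.
  by rewrite /resample /subtorus_param/= (asboolT Ai).
- have := measurableT_comp (measurable_coord i)
    (@measurable_fst _ _ T T) measurableT mB.
  rewrite setTI; congr (measurable _); apply/funext => -[z x] /=.
  by rewrite /resample /subtorus_param/= (asboolF Ai).
Qed.

Definition orthant b : set T := [set x | forall i, ((x : nat -> R) i)%:E < b i]%E.

(* Extended bounds make this a pi-system: an orthant constraining n coordinates
   is also one constraining m >= n coordinates. *)
Definition orthants : set (set T) :=
  [set S | exists n b, (forall i, (n <= i)%N -> b i = +oo%E) /\ S = orthant b].

Lemma measurable_orthant b : measurable (orthant b).
Proof.
have -> : orthant b = \bigcap_i [set x : T | ((x : nat -> R) i)%:E < b i]%E.
  by apply/seteqP; split => [x xb i _|x xb i]; apply: xb.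
apply: bigcapT_measurable => i.
rewrite -[X in measurable X]setTI; apply: measurable_lte => //.
apply/measurable_EFinP; exact: measurable_coord.
Qed.

Lemma orthants_setI : setI_closed orthants.
Proof.
move=> _ _ [n [b [bn ->]]] [m [c [cm ->]]].
exists (maxn n m), (fun i => Order.min (b i) (c i)); split => [i|].
  by rewrite geq_max => /andP[/bn -> /cm ->]; rewrite minxx.
apply/seteqP; split => x /= => [[xb xc] i|xbc].
  by rewrite lt_min xb xc.
by split => i; have := xbc i; rewrite lt_min => /andP[].
Qed.

(** Open left rays generate the Borel sets, and the preimage of such a ray under a coordinate is an
    orthant with a single finite bound. *)
Lemma measurable_orthantsE : @measurable _ T = <<s orthants >>.
Proof.
apply/seteqP; split; last first.
  apply: smallest_sub; first exact: smallest_sigma_algebra.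
  by move=> _ [n [b [_ ->]]]; exact: measurable_orthant.
apply: smallest_sub; first exact: smallest_sigma_algebra.
move=> _ [i [B [mB ->]]].
suff /(_ measurableT B mB) : measurable_fun setT
    (fun x : g_sigma_algebraType orthants => (x : nat -> R) i).
  by rewrite setTI.
apply: (measurability (@RGenInftyO.G R)).
  exact: RGenInftyO.measurableE.
move=> _ [_ [t ->] <-]; rewrite setTI; apply: sub_sigma_algebra.
exists i.+1, (fun j => if j == i then t%:E else +oo%E); split.
  by move=> j ij; rewrite gtn_eqF.
apply/seteqP; split => x /=; rewrite in_itv/=.
  by move=> xt j; case: eqP => [->|_]; rewrite ?lte_fin ?ltry.
by move=> /(_ i); rewrite eqxx lte_fin.
Qed.

(** The distribution function of the uniform law on [0,1]. *)
Definition clamp01 (e : \bar R) : R :=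
  match e with r%:E => Num.max 0 (Num.min r 1) | +oo%E => 1 | -oo%E => 0 end.

Lemma clamp01_itv e : 0 <= clamp01 e <= 1.
Proof. by case: e => [r| |] /=; rewrite ?ge_max ?le_max ?lexx ?ler01 ?ge_min ?lexx ?orbT. Qed.

Lemma lt_clamp01 (t : R) e : 0 <= t < 1 -> (t < clamp01 e) = (t%:E < e)%E.
Proof.
move=> /andP[t0 t1]; case: e => [r| |] /=.
- by rewrite lte_fin lt_max lt_min t1 andbT ltNge t0.
- by rewrite t1 ltry.
- by rewrite !ltNge t0 leNye.
Qed.

Context {P : probability T R}.
Hypothesis hP : is_uniform_product P.

(** The unit cube in the first n coordinates has mass 1, so the orthant may be cut down to it; what
    remains is a box with sides [clamp01 (b i)]. *)
Lemma orthant_prob n b : (forall i, (n <= i)%N -> b i = +oo%E) ->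
  P (orthant b) = (\prod_(i < n) clamp01 (b i))%:E.
Proof.
move=> bn.
pose cube (c : nat -> R) : set T :=
  [set x : T | forall i, (i < n)%N -> 0 <= (x : nat -> R) i < c i].
have mcube c : measurable (cube c) by exact: measurable_box.
have Pcube c : (forall i, 0 <= c i <= 1) -> P (cube c) = (\prod_(i < n) c i)%:E.
  move=> c01; rewrite (@hP n (fun=> 0) c).
    by under eq_bigr do rewrite subr0.
  by move=> i _; have /andP[? ?] := c01 i; rewrite lexx.
have P1 : P (cube (fun=> 1)) = 1%E.
  by rewrite Pcube ?big1// => i; rewrite ler01 lexx.
have mo := measurable_orthant b.
rewrite -(Pcube (fun i => clamp01 (b i))); last by move=> i; exact: clamp01_itv.
have -> : cube (fun i => clamp01 (b i)) = orthant b `&` cube (fun=> 1).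
  apply/seteqP; split => x.
    move=> xb; split => i => [|ni].
      have [ni|/bn ->] := ltnP i n; last exact: ltry.
      have /andP[x0 xc] := xb i ni; have /andP[_ c1] := clamp01_itv (b i).
      by rewrite -lt_clamp01// x0 (lt_le_trans xc).
    have /andP[-> xc] := xb i ni; have /andP[_ c1] := clamp01_itv (b i).
    by rewrite (lt_le_trans xc).
  move=> [xb x1] i ni; have /andP[x0 xi1] := x1 i ni.
  by rewrite x0 lt_clamp01 ?xb ?x0.
have D0 : P (orthant b `\` cube (fun=> 1)) = 0%E.
  apply/eqP; rewrite eq_le measure_ge0 andbT.
  have -> : 0%E = P (~` cube (fun=> 1)) by rewrite probability_setC// P1 subee.
  apply: le_measure => [||x []//]; rewrite inE; first exact: measurableD.
  exact: measurableC.
rewrite -[in LHS](setDUK (_ : orthant b `&` cube (fun=> 1) `<=` orthant b))//.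
rewrite measureU//; last 3 first.
- exact: measurableI.
- by apply: measurableD => //; exact: measurableI.
- by rewrite setDIK.
by rewrite setDIr setDv set0U [X in (_ + X)%E]D0 adde0.
Qed.

(** The preimage of an orthant is a product of two orthants: each bound goes to exactly one factor
    and the other factor gets +oo there, of mass 1, so the probabilities multiply back. Uniqueness
    of measures on a pi-system does the rest. *)
Lemma resample_preserves A (E : set T) : measurable E ->
  (P \x P)%E (resample A @^-1` E) = P E.
Proof.
move=> mE.
have mr := measurable_resample A.
pose m2 := pushforward (P \x P)%E (resample A).
suff : m2 E = P E by [].
apply: (measure_unique orthants (fun=> setT)) => //.
- exact: measurable_orthantsE.
- exact: orthants_setI.
- move=> _; exists 0%N, (fun=> +oo%E); split => //.
  by apply/seteqP; split => // x _ i; rewrite ltry.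
- by rewrite bigcup_const.
- move=> _ [n [b [bn ->]]]; rewrite /m2 /pushforward.
  pose bA i := if `[< A i >] then b i else +oo%E.
  pose bC i := if `[< A i >] then +oo%E else b i.
  transitivity ((P \x P)%E (orthant bC `*` orthant bA)).
    congr ((P \x P)%E _).
    apply/seteqP; split => -[z x] /=.
      move=> H; split => i; have := H i; rewrite /bA /bC /resample /subtorus_param;
      by case: ifP => //; rewrite ltry.
    move=> [/= zb xb] i; have := zb i; have := xb i.
    by rewrite /bA /bC /resample /subtorus_param; case: ifP.
  transitivity (P (orthant bC) * P (orthant bA))%E.
    by apply: product_measure1E; exact: measurable_orthant.
  rewrite -[RHS]/(P (orthant b)) !(@orthant_prob n)//; last 2 first.
  - by move=> i ni; rewrite /bA bn// if_same.
  - by move=> i ni; rewrite /bC bn// if_same.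
  rewrite -EFinM -big_split/=; congr (_%:E); apply: eq_bigr => i _.
  by rewrite /bA /bC; case: ifP => _; rewrite ?mul1r ?mulr1.
- move=> _; apply: (@le_lt_trans _ _ 1%E); last exact: ltry.
  suff : (P \x P)%E (setT `*` setT) = 1%E.
    move=> <-; rewrite le_eqVlt; apply/orP; left; apply/eqP.
    by congr ((P \x P)%E _); apply/seteqP.
  transitivity (P setT * P setT)%E; first exact: product_measure1E.
  by rewrite probability_setT mule1.
Qed.

End resampling.

(** * Elementary measure estimates *)

Lemma measure_tail_small d (U : measurableType d) (R : realType)
    (mu : probability U R) (F : (set U)^nat) (e : R) : 0 < e ->
  (forall n, measurable (F n)) -> {homo F : n m / (n <= m)%N >-> (m <= n)%O} ->
  \bigcap_n F n = set0 -> exists n, (mu (F n) <= e%:E)%E.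
Proof.
move=> e0 mF dF F0.
have : (mu \o F) x @[x --> \oo] --> mu (\bigcap_n F n).
  apply: nonincreasing_cvg_mu => //; last by rewrite F0.
  by rewrite (le_lt_trans (probability_le1 mu (mF 0%N)))// ltry.
rewrite F0 measure0 => /(_ [set x | x < e%:E]%E) [].
  by apply: open_nbhs_nbhs; split; [exact: open_ereal_lt_ereal|rewrite /= lte_fin].
by move=> n _ /(_ n (leqnn n))/ltW; exists n.
Qed.

Lemma lee_split (R : realType) (x y : \bar R) (e : R) :
  (x <= (e / 2)%:E -> y <= (e / 2)%:E -> x + y <= e%:E)%E.
Proof. by move=> xe ye; rewrite [e in leRHS]splitr EFinD leeD. Qed.

Lemma measure_sub_cover2 d (U : measurableType d) (R : realType)
    (mu : {measure set U -> \bar R}) (A B C : set U) (e : R) :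
  measurable A -> measurable B -> measurable C -> A `<=` B `|` C ->
  (mu B <= (e / 2)%:E -> mu C <= (e / 2)%:E -> mu A <= e%:E)%E.
Proof.
move=> mA mB mC ABC Be Ce; apply: (le_trans _ (lee_split Be Ce)).
apply: (le_trans _ (measureU2 _ mB mC)); apply: le_measure; rewrite ?inE//.
exact: measurableU.
Qed.

(** * Approximation in measure by finitely many coordinates *)

Section cylinder_stability.
Context {R : realType}.
Local Notation T := (Tinf R).
Context {P : probability T R} {Q : {measure set (T * T) -> \bar R}}.
Hypothesis resample_preservesQ :
  forall A (E : set T), measurable E -> Q (resample A @^-1` E) = P E.
Implicit Types (A B : set nat) (E : set T) (N : nat).

Definition agree_below N A B := forall i, (i < N)%N -> A i <-> B i.

Lemma agree_below_sym N A B : agree_below N A B -> agree_below N B A.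
Proof. by move=> AB i /AB[]. Qed.

Lemma agree_below_le N M A B : (N <= M)%N -> agree_below M A B -> agree_below N A B.
Proof. by move=> NM AB i iN; apply: AB; exact: leq_trans NM. Qed.

(* E is a limit in measure of cylinder sets, phrased through resampling. *)
Definition stable E := measurable E /\ forall e : R, 0 < e ->
  exists N, forall A B, agree_below N A B ->
    (Q (resample A @^-1` E `\` resample B @^-1` E) <= e%:E)%E.

Lemma measurable_resample_preimage A E :
  measurable E -> measurable (resample A @^-1` E).
Proof. by move=> mE; rewrite -[X in measurable X]setTI; exact: measurable_resample. Qed.
Hint Resolve measurable_resample_preimage : core.

Lemma stable0 : stable set0.
Proof.
split=> // e e0; exists 0%N => A B _.
by rewrite preimage_set0 set0D measure0 lee_fin ltW.
Qed.

Lemma stableC E : stable E -> stable (~` E).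
Proof.
move=> [mE sE]; split; first exact: measurableC.
move=> e /sE[N NE]; exists N => A B AB; have := NE _ _ (agree_below_sym AB).
congr (Q _ <= _)%E; apply/seteqP; split => w [Ew nEw]; split => //.
by apply: contrapT.
Qed.

Lemma stableU E F : stable E -> stable F -> stable (E `|` F).
Proof.
move=> [mE sE] [mF sF]; split; first exact: measurableU.
move=> e e0; have e20 : 0 < e / 2 by lra.
have [N NE] := sE _ e20; have [M MF] := sF _ e20.
exists (maxn N M) => A B AB.
apply: (measure_sub_cover2 _ _ _ _ (NE A B _) (MF A B _)).
- by apply: measurableD; apply: measurable_resample_preimage; exact: measurableU.
- by apply: measurableD; exact: measurable_resample_preimage.
- by apply: measurableD; exact: measurable_resample_preimage.
- by move=> w [[Ew|Fw] /not_orP[nE nF]]; [left|right].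
- exact: agree_below_le (leq_maxl _ _) AB.
- exact: agree_below_le (leq_maxr _ _) AB.
Qed.

(** A finite union approximates the countable one in P. Every resampling preserves measure, so the
    same error bound holds for all A at once, and the threshold of the finite union serves for the
    whole. *)
Lemma stable_bigcup (F : (set T)^nat) :
  (forall n, stable (F n)) -> stable (\bigcup_n F n).
Proof.
move=> sF; have mF n : measurable (F n) by have [] := sF n.
have mU : measurable (\bigcup_n F n) by exact: bigcupT_measurable.
split=> // e e0; have e20 : 0 < e / 2 by lra.
pose U n := \big[setU/set0]_(i < n) F i.
have sU n : stable (U n).
  elim: n => [|n IHn]; first by rewrite /U big_ord0; exact: stable0.
  by rewrite /U big_ord_recr; exact: stableU.
have [n ne] : exists n, (P (\bigcup_n F n `\` U n) <= (e / 2)%:E)%E.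
  apply: measure_tail_small => //.
  - by move=> n; apply: measurableD => //; have [] := sU n.
  - move=> n m nm; apply/subsetPset => x [Fx nU]; split => // Unx; apply: nU.
    exact: (subset_bigsetU nm).
  - apply/seteqP; split => // x xF; have [[k _ Fkx] _] := xF 0%N I.
    have [_] := xF k.+1 I; apply; rewrite /U big_ord_recr/=; by right.
have [mUn /(_ _ e20)[N NU]] := sU n.
exists N => A B AB; rewrite -(resample_preservesQ A) in ne; last exact: measurableD.
apply: (measure_sub_cover2 _ _ _ _ ne (NU A B AB)).
- by apply: measurableD; exact: measurable_resample_preimage.
- by apply: measurable_resample_preimage; exact: measurableD.
- by apply: measurableD; exact: measurable_resample_preimage.
- move=> w [Aw nB]; have [Uw|nUw] := pselect (U n (resample A w)).
    right; split => //; apply: contra_not nB.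
    by rewrite /U -bigcup_mkord => -[k _ Fk]; exists k.
  by left.
Qed.

Lemma measurable_stable E : measurable E -> stable E.
Proof.
apply: smallest_sub.
  split; first exact: stable0.
  - by move=> F; rewrite setTD; exact: stableC.
  - exact: stable_bigcup.
move=> _ [i [B [mB ->]]]; split.
  by rewrite -[X in measurable X]setTI; exact: measurable_coord.
(* Sets agreeing below [i.+1] resample coordinate i alike, so the difference is empty. *)
move=> e e0; exists i.+1 => A A' AA'.
rewrite [X in Q X](_ : _ = set0) ?measure0 ?lee_fin ?ltW//.
apply/seteqP; split => // -[z x] [].
rewrite /resample /subtorus_param /=.
by have /asbool_equiv_eq -> := AA' i (leqnn _).
Qed.

(** Crossing t upwards from A to B means lying in the A-preimage of {g < t} but not in the
    B-preimage, which stability makes rare. This turns stability of sets into a statement about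
    functions. *)
Lemma resample_crossing (g : T -> R) (s : seq R) (e : R) :
  measurable_fun setT g -> 0 < e ->
  exists N, forall A B, agree_below N A B ->
    let C := [set w | has (fun t => g (resample A w) < t <= g (resample B w)) s] in
    measurable C /\ (Q C <= e%:E)%E.
Proof.
move=> mg; elim: s e => [|t s IHs] e e0.
  exists 0%N => A B _ C; have -> : C = set0 by apply/seteqP; split.
  by rewrite measure0 lee_fin ltW.
have e20 : 0 < e / 2 by lra.
pose E := g @^-1` `]-oo, t[.
have mE : measurable E by rewrite -[X in measurable X]setTI; exact: mg.
have [_ /(_ _ e20)[N NE]] := measurable_stable mE.
have [M MC] := IHs _ e20.
exists (maxn N M) => A B AB.
have [mC QC] := MC A B (agree_below_le (leq_maxr _ _) AB).
have {}NE := NE A B (agree_below_le (leq_maxl _ _) AB).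
move=> C; have -> : C = (resample A @^-1` E `\` resample B @^-1` E) `|`
  [set w | has (fun t => g (resample A w) < t <= g (resample B w)) s].
  have EP w : E w <-> g w < t by rewrite /E /= in_itv.
  rewrite {}/C; apply/seteqP; split => w /=.
    by move=> /orP[/andP[At tB]|]; [left|right] => //; split; rewrite EP//; apply/negP; rewrite -leNgt.
  by case => [[/EP -> /EP/negP]|->]; rewrite ?orbT// -leNgt => ->.
have mD : measurable (resample A @^-1` E `\` resample B @^-1` E).
  by apply: measurableD; exact: measurable_resample_preimage.
split; first exact: measurableU.
by apply: (measure_sub_cover2 _ _ _ _ NE QC) => //; exact: measurableU.
Qed.

Lemma measurable_far d (U : measurableType d) (u v : U -> R) (e : R) :
  measurable_fun setT u -> measurable_fun setT v ->
  measurable [set w | e < `|u w - v w|].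
Proof.
move=> mu mv; have mn := measurableT_comp (@normr_measurable R setT) (measurable_funB mu mv).
have := mn measurableT `]e, +oo[%classic (measurable_itv _).
rewrite setTI; congr (measurable _).
by apply/seteqP; split => w /=; rewrite in_itv/= andbT.
Qed.

Lemma measurable_fun_tight (g : T -> R) (e : R) :
  measurable_fun setT g -> 0 < e ->
  exists K : R, (P [set x | (K < `|g x|)%R] <= e%:E)%E.
Proof.
move=> mg e0; have [] := @measure_tail_small _ _ _ P (fun n => [set x | n%:R < `|g x|]) e e0.
- move=> n; have := @measurable_far _ _ g (fun=> 0) n%:R mg (measurable_cst _).
  by under eq_set do rewrite subr0.
- move=> n m nm; apply/subsetPset => x /=; apply: le_lt_trans.
  by rewrite ler_nat.
- apply/seteqP; split => // x /(_ (Num.trunc `|g x|).+1 I) /=.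
  by rewrite ltNge ltW// truncnS_gt.
- by move=> n ne; exists n%:R.
Qed.

Lemma resample_close (g : T -> R) (d e : R) :
  measurable_fun setT g -> 0 < d -> 0 < e ->
  exists N, forall A B, agree_below N A B ->
    (Q [set w | (d < `|g (resample A w) - g (resample B w)|)%R] <= e%:E)%E.
Proof.
(* Four exceptional events share e: crossings in either direction, and large values of g at either
   resampling. *)
move=> mg d0 e0; have e40 : 0 < e / 2 / 2 by lra.
have [K PK] := measurable_fun_tight mg e40.
(* A grid of mesh d: the first level strictly above a point of [-K, K] has index at most
   [Num.trunc (2 * K / d) + 1], and a gap larger than d must cross it. *)
pose s := [seq k%:R * d - K | k <- iota 0 (Num.trunc (2 * K / d)).+2].
have [N NC] := resample_crossing s mg e40.
exists N => A B AB.
have [mC QC] := NC A B AB.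
have [mC' QC'] := NC B A (agree_below_sym AB).
set C := [set w | _] in mC QC; set C' := [set w | _] in mC' QC'.
set G := [set x | _] in PK.
have mG : measurable G.
  have := @measurable_far _ _ g (fun=> 0) K mg (measurable_cst _).
  by under eq_set do rewrite subr0.
have mrg X : measurable_fun setT (g \o resample X).
  exact: measurableT_comp mg (measurable_resample X).
have QCC : (Q (C `|` C') <= (e / 2)%:E)%E.
  by apply: (measure_sub_cover2 _ _ _ _ QC QC') => //; exact: measurableU.
have mrG X : measurable (resample X @^-1` G) by exact: measurable_resample_preimage.
have PKA := PK; rewrite -(resample_preservesQ A mG) in PKA.
rewrite -(resample_preservesQ B mG) in PK.
have QGG : (Q (resample A @^-1` G `|` resample B @^-1` G) <= (e / 2)%:E)%E.
  by apply: (measure_sub_cover2 _ _ _ _ PKA PK) => //; exact: measurableU.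
apply: (measure_sub_cover2 _ _ _ _ QCC QGG).
- exact: (measurable_far _ (mrg A) (mrg B)).
- exact: measurableU.
- exact: measurableU.
have cross (x y : R) : `|x| <= K -> d < y - x -> has (fun t => x < t <= y) s.
  move=> xK dxy; have xKd : 0 <= (x + K) / d.
    by rewrite divr_ge0 ?(ltW d0)//; move: xK; rewrite ler_norml; lra.
  have /andP[k0 k1] := truncn_itv xKd.
  set k := Num.trunc _ in k0 k1.
  apply/hasP; exists (k.+1%:R * d - K).
    apply/mapP; exists k.+1 => //; rewrite mem_iota /= add0n !ltnS le_truncn//.
    by rewrite ler_pM2r ?invr_gt0//; move: xK; rewrite ler_norml; lra.
  rewrite ler_pdivlMr// in k0; rewrite ltr_pdivrMr// in k1.
  rewrite -natr1 in k1 *; apply/andP; split; lra.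
move=> w /= dw; rewrite /G /=.
have [|KA] := ltP K `|g (resample A w)|; first by right; left.
have [|KB] := ltP K `|g (resample B w)|; first by right; right.
left; move: dw; rewrite ltr_normr; move=> /orP[dw|dw]; [right|left].
  by apply: cross => //.
by apply: cross => //; lra.
Qed.

End cylinder_stability.

(** * Measurable versions and sections of product sets *)

Lemma completion_measurable_ae (R : realType) (P : probability (Tinf R) R)
    (f : Tinf R -> R) : completion_measurable_fun P f ->
  exists (g : Tinf R -> R) (Z : set (Tinf R)), [/\ measurable_fun setT g,
    measurable Z, P Z = 0%E & forall x, ~ Z x -> f x = g x].
Proof.
(* Rational levels keep the exceptional null sets countable in number; codes that decode to nothing
   merely repeat the level 0. *)
move=> fmeas; pose q n : R := ratr (odflt 0 (unpickle n)).
have /choice[B HB] n : exists B, measurable B /\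
    P.-negligible (f @^-1` `]-oo, q n[ `\` B `|` B `\` f @^-1` `]-oo, q n[).
  by apply: fmeas; exact: measurable_itv.
have mB n : measurable (B n) by have [] := HB n.
have [Z [mZ Z0 ZB]] := negligible_bigcup (fun n => (HB n).2).
have BP n x : ~ Z x -> B n x <-> f x < q n.
  have fqE : (f @^-1` `]-oo, q n[) x = (f x < q n) :> Prop by rewrite /= in_itv.
  move=> nZ; split => H; apply: contrapT => nH; apply: nZ; apply: ZB; exists n => //.
    by right; split => //; rewrite fqE.
  by left; split => //; rewrite fqE.
exists (fun x => if `[< Z x >] then 0 else f x), Z; split => //; last first.
  by move=> x nZ; rewrite asboolF.
apply: (measurability (@RGenInftyO.G R)); first exact: RGenInftyO.measurableE.
move=> _ [_ [t ->] <-]; rewrite setTI.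
(* On Z the new function is 0, so Z contributes entirely or not at all, according to the sign of
   t. *)
rewrite [X in measurable X](_ : _ = (Z `&` [set _ | 0 < t]) `|`
   (~` Z `&` \bigcup_(n in [set n | q n < t]) B n)).
  apply: measurableU.
    by have [t0|t0] := boolP (0 < t);
      rewrite (_ : [set _ | _] = if 0 < t then setT else set0) ?(negbTE t0) ?t0 ?setIT ?setI0//;
      apply/seteqP; split; rewrite ?t0 ?(negbTE t0).
  by apply: measurableI; [exact: measurableC|exact: bigcup_measurable].
apply/seteqP; split => x /=; rewrite in_itv/=.
  case: asboolP => Zx; first by left.
  move=> /rat_in_itvoo[r]; rewrite in_itv/= => /andP[fr rt]; right; split => //.
  have qr : q (pickle r) = ratr r by rewrite /q pickleK.
  by exists (pickle r); rewrite /= ?qr//; apply/BP; rewrite ?qr.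
case: asboolP => Zx [[]//|[//]].
by move=> _ [n /= qt] /(BP _ _ Zx) fq; exact: lt_trans qt.
Qed.

(** Markov's inequality for the measure of the section, whose integral is the product measure. *)
Lemma xsection_markov d1 d2 (T1 : measurableType d1) (T2 : measurableType d2)
    (R : realType) (m1 : {measure set T1 -> \bar R})
    (m2 : {sigma_finite_measure set T2 -> \bar R}) (W : set (T1 * T2)) (c : R) :
  measurable W -> 0 < c ->
  measurable [set z | c%:E <= m2 (xsection W z)]%E /\
  (c%:E * m1 [set z | c%:E <= m2 (xsection W z)] <= (m1 \x m2) W)%E.
Proof.
move=> mW c0; have mx := measurable_fun_xsection m2 mW.
have -> : [set z | c%:E <= m2 (xsection W z)]%E =
    [set: T1] `&` [set z | c%:E <= `|m2 (xsection W z)|]%E.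
  by rewrite setTI; apply/seteqP; split => z /=; rewrite gee0_abs.
split; first by apply: measurable_lee => //; exact: measurableT_comp.
have := @le_integral_comp_abse _ _ _ m1 _ measurableT _ c id
  (@measurable_id _ _ setT) (fun _ => id) (fun _ _ _ _ => id) mx c0.
move=> /le_trans; apply; rewrite le_eqVlt; apply/orP; left; apply/eqP.
by apply: eq_integral => z _ /=; rewrite gee0_abs.
Qed.

(** * Choosing the coordinates of the subtorus *)

Section lipschitz.
Context {R : realType}.
Local Notation T := (Tinf R).
Context {P : probability T R}.
Hypothesis hP : is_uniform_product P.

(** An inequality, since [s] may repeat entries or reach past n, which only adds factors at most 1
    on the left. *)
Lemma prod_indicator_ge (r : R) (s : seq nat) n : 0 < r -> r <= 1 ->
  r ^+ size s <= \prod_(j < n) (if (j : nat) \in s then r else 1).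
Proof.
move=> r0 r1; rewrite -big_mkcond/= (eq_bigl (mem [pred j : 'I_n | (j : nat) \in s]))//.
rewrite prodr_const; apply: ler_wiXn2l; rewrite ?(ltW r0)//.
rewrite cardE -(size_map val); apply: uniq_leq_size.
  by rewrite map_inj_uniq ?enum_uniq//; exact: val_inj.
by move=> j /mapP[i]; rewrite mem_enum => si ->.
Qed.

(** The lower bound depends on [r] and [size s] alone, hence is uniform in x and in the position of
    the coordinates. *)
Lemma small_box (r : R) (s : seq nat) (x : nat -> R) : 0 < r -> r <= 1 ->
  exists D : set T, [/\ measurable D, ((r ^+ size s)%:E <= P D)%E &
    forall y : T, D y -> forall j, j \in s -> cdist (x j) ((y : nat -> R) j) <= r].
Proof.
move=> r0 r1.
have /choice[a ax] j : exists a, 0 <= a <= 1 - r /\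
    forall y, a <= y < a + r -> cdist (x j) y <= r.
  by have [a a0 ay] := cdist_itv (x j) r0 r1; exists a.
pose lo j := if j \in s then a j else 0.
pose hi j := if j \in s then a j + r else 1.
pose n := (\max_(j <- s) j).+1.
have sn j : j \in s -> (j < n)%N by move=> js; rewrite ltnS; exact: leq_bigmax_seq.
exists [set y : T | forall j, (j < n)%N -> lo j <= (y : nat -> R) j < hi j]; split.
- exact: measurable_box.
- rewrite (@hP n lo hi).
    rewrite lee_fin (le_trans (prod_indicator_ge s n r0 r1))// le_eqVlt.
    apply/orP; left; apply/eqP; apply: eq_bigr => j _.
    by rewrite /lo /hi; case: ifP => _; [ring|rewrite subr0].
  move=> j _; rewrite /lo /hi; have [/andP[a0 a1] _] := ax j.
  by case: ifP => _; split; rewrite ?lexx ?ler01//; lra.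
- move=> y yD j js; apply: (ax j).2; have := yD j (sn j js).
  by rewrite /lo /hi js.
Qed.

Context {p : \bar R} {f : T -> R} {L : R} {g : T -> R} {Z : set T}.
Hypotheses (p1 : (1%:E < p)%E) (L0 : 0 < L).
Hypothesis fL : forall x y : nat -> R, (`|f x - f y|%:E <= L%:E * dist_p p x y)%E.
Hypotheses (mg : measurable_fun setT g) (mZ : measurable Z) (Z0 : P Z = 0%E).
Hypothesis fg : forall x, ~ Z x -> f x = g x.

Local Notation Q := ((P \x P)%E : {measure set (T * T) -> \bar R}).

Let QE A (E : set T) : measurable E -> Q (resample A @^-1` E) = P E.
Proof. exact: resample_preserves. Qed.

Lemma measurable_resample_far A B (d : R) :
  measurable [set w | d < `|g (resample A w) - g (resample B w)|].
Proof.
apply: measurable_far; apply: (measurableT_comp mg); exact: measurable_resample.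
Qed.

Lemma resampleZ0 A : measurable (resample A @^-1` Z) /\ Q (resample A @^-1` Z) = 0%E.
Proof. by split; [exact: measurable_resample_preimage|rewrite QE]. Qed.

Lemma small_oscillation (s : seq nat) (d eta : R) : 0 < d -> 0 < eta ->
  exists (i : nat) (Bad : set T), [/\ forall j, j \in s -> (j < i)%N,
    measurable Bad, (P Bad <= eta%:E)%E &
    forall z x, ~ Bad z -> `|f (subtorus_param [set` i :: s] z x) -
                            f (subtorus_param [set` s] z x)| <= d].
Proof.
move=> d0 eta0.
pose k : R := (size s).+1%:R.
have k0 : 0 < k by rewrite ltr0n.
(* Moving all k coordinates of [i :: s] by r costs at most d / 3. *)
pose r := Num.min 1 (d / 3 / (L * k)).
have r0 : 0 < r by rewrite lt_min ltr01 !divr_gt0// mulr_gt0.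
have r1 : r <= 1 by rewrite ge_min lexx.
have rd : L * r * k <= d / 3.
  have : r <= d / 3 / (L * k) by rewrite ge_min lexx orbT.
  by rewrite ler_pdivlMr ?mulr_gt0// => h; rewrite (_ : L * r * k = r * (L * k))//; ring.
have d30 : 0 < d / 3 by lra.
(* c bounds below the probability of an r-box in the coordinates i :: s; it does
   not depend on i, which can thus be chosen after c. *)
pose c := r ^+ (size s).+1.
have c0 : 0 < c by exact: exprn_gt0.
(* Closeness is required up to [c * eta] so that Markov's inequality at level c leaves at most
   eta. *)
have [N NQ] := resample_close QE mg d30 (mulr_gt0 c0 eta0).
pose i := maxn N (\max_(j <- s) j).+1.
have si j : j \in s -> (j < i)%N.
  by move=> js; rewrite leq_max ltnS [X in _ || X]leq_bigmax_seq ?orbT.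
pose A := [set` i :: s]; pose B := [set` s].
have AB : agree_below N A B.
  move=> j jN; rewrite /A /B /= inE (_ : (j == i) = false)//.
  by apply/negbTE; rewrite neq_ltn (leq_trans jN) ?leq_maxl.
pose W0 := [set w | d / 3 < `|g (resample A w) - g (resample B w)|].
pose W := W0 `|` (resample A @^-1` Z `|` resample B @^-1` Z).
have mW0 : measurable W0 by exact: measurable_resample_far.
have [mA QA] := resampleZ0 A; have [mB QB] := resampleZ0 B.
have mAB : measurable (resample A @^-1` Z `|` resample B @^-1` Z) by exact: measurableU.
have mW : measurable W by exact: measurableU.
have QW : (Q W <= (c * eta)%:E)%E.
  apply: (le_trans (measureU2 _ mW0 mAB)).
  rewrite (le_trans _ (NQ A B AB))// -[leRHS]adde0 leeD2l//.
  by rewrite (le_trans (measureU2 _ mA mB))// [X in (X + _)%E]QA [X in (_ + X)%E]QB adde0.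
have [mBad Badc] := xsection_markov P P mW c0.
set Bad := [set z | _] in mBad Badc.
exists i, Bad; split => //.
  have : (c%:E * P Bad <= c%:E * eta%:E)%E by rewrite -EFinM; exact: le_trans QW.
  by rewrite lee_pmul2l.
move=> z x /negP; rewrite -ltNge => zx.
have [D [mD cD Dr]] := small_box (i :: s) x r0 r1.
(* For good z the section of W has mass below c, so it cannot contain the r-box around x. At y the
   two resamplings are close, and the Lipschitz bound carries this back to x. *)
have [y [Dy nWy]] : exists y, D y /\ ~ W (z, y).
  apply: contrapT => /forallNP nDW; move: zx; apply/negP; rewrite -leNgt.
  apply: (le_trans cD); apply: le_measure; rewrite ?inE//.
    exact: measurable_xsection.
  by move=> y Dy; apply/xsectionP; apply: contrapT => nW; apply: (nDW y).
have /not_orP[nW0 /not_orP[nA nB]] := nWy.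
have fAxy : `|f (subtorus_param A z x) - f (subtorus_param A z y)| <= d / 3.
  apply: le_trans rd.
  apply: (@lipschitz_finite_change _ p f L r (i :: s) _ _ p1 (ltW L0) (ltW r0) fL) => j js.
    by rewrite /subtorus_param asboolT//; exact: Dr.
  by rewrite /subtorus_param asboolF//; exact/negP.
have fBxy : `|f (subtorus_param B z x) - f (subtorus_param B z y)| <= d / 3.
  apply: le_trans rd.
  apply: (@lipschitz_finite_change _ p f L r (i :: s) _ _ p1 (ltW L0) (ltW r0) fL) => j js.
    rewrite /subtorus_param; case: asboolP => jB; first exact: Dr.
    by rewrite cdistxx ltW.
  by rewrite /subtorus_param asboolF// /B/= => sj; rewrite inE sj orbT in js.
have fABy : `|f (subtorus_param A z y) - f (subtorus_param B z y)| <= d / 3.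
  by move: nW0 => /negP; rewrite -leNgt (fg nA) (fg nB).
move: fAxy fBxy fABy; rewrite -/A -/B !ler_norml; lra.
Qed.

Lemma nearly_constant_subtorus (K d : R) :
  (P [set x | (K < `|g x|)%R] <= (1 / 4)%:E)%E -> 0 < d ->
  exists (A : set nat) (b : nat -> R) (c : R), [/\ infinite_set A, `|c| <= K &
    {ae P, forall x : T, `|f (subtorus_param A b x) - c| <= d}].
Proof.
(* Half of the tolerance is for finite modifications, half for the passage to the infinite set. *)
move=> PK; move: d => d2 d20; pose d := d2 / 2.
have d0 : 0 < d by rewrite divr_gt0.
(* [h s] is the next coordinate with its bad set; the geometric weights sum to at most d for the
   oscillations and 1/4 for the probabilities. *)
have /choice[h hs] (s : seq nat) : exists h : nat * set T,
    [/\ forall j, j \in s -> (j < h.1)%N, measurable h.2,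
      (P h.2 <= (1 / 4 / (2 ^ (size s).+1)%:R)%:E)%E &
      forall z x, ~ h.2 z -> `|f (subtorus_param [set` h.1 :: s] z x) -
                              f (subtorus_param [set` s] z x)| <= d / (2 ^ (size s).+1)%:R].
  have pos (e : R) : 0 < e -> 0 < e / (2 ^ (size s).+1)%:R.
    by move=> e0; rewrite divr_gt0// ltr0n expn_gt0.
  have [|i [Bad [? ? ? ?]]] := @small_oscillation s _ (1 / 4 / (2 ^ (size s).+1)%:R) (pos _ d0).
    by apply: pos; lra.
  by exists (i, Bad).
pose ss k := iter k (fun s => (h s).1 :: s) [::].
have size_ss k : size (ss k) = k by elim: k => //= k ->.
have ss_le m k : (m <= k)%N -> {subset ss m <= ss k}.
  move=> mk; rewrite -(subnK mk); elim: (k - m)%N => [//|l IHl] j /IHl jl.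
  by rewrite addSn /= inE jl orbT.
(* Chosen coordinates increase strictly, so late ones are large: this gives both agreement of A with
   its finite stages and infinitude of A. *)
have next_ge m : (m <= (h (ss m)).1)%N.
  elim: m => // m IHm; apply: leq_ltn_trans IHm _.
  by have [+ _ _ _] := hs (ss m.+1); apply; rewrite /= mem_head.
pose A := [set j | exists k, j \in ss k].
have Ass k : agree_below k A [set` ss k].
  move=> i ik; split; last by exists k.
  case=> m; elim: m => [//|m IHm] /=; rewrite inE => /orP[/eqP im|/IHm//].
  have mk : (m < k)%N by rewrite (leq_ltn_trans (next_ge m))// -im.
  by apply: (ss_le _ _ mk); rewrite /= im mem_head.
have Ainf : infinite_set A.
  move=> /finite_seqP[s As]; pose m := (\max_(j <- s) j).+1.
  have : A (h (ss m)).1 by exists m.+1; rewrite /= mem_head.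
  rewrite As /= => /leq_bigmax_seq => /(_ xpredT id isT).
  by rewrite leqNgt (leq_trans _ (next_ge m)).
pose Bad := \bigcup_k (h (ss k)).2.
have mh k : measurable (h (ss k)).2 by have [] := hs (ss k).
have mBad : measurable Bad by exact: bigcupT_measurable.
have PBad : (P Bad <= (1 / 4)%:E)%E.
  apply: le_trans (measure_sigma_subadditive P mh mBad (@subset_refl _ _)) _.
  have q0 : 0 <= 1 / 4 :> R by lra.
  apply: le_trans (epsilon_trick0 xpredT q0); apply: lee_nneseries => // k _.
  by have [_ _ + _] := hs (ss k); rewrite size_ss.
have osc z x k : ~ Bad z -> `|f (subtorus_param [set` ss k] z x) - f z| <= d.
  (* Subtracting the unspent part [d / 2 ^ k] makes the induction telescope. *)
  move=> nz; suff : `|f (subtorus_param [set` ss k] z x) - f z| <= d - d / (2 ^ k)%:R.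
    move=> /le_trans; apply; rewrite gerBl divr_ge0 ?(ltW d0)//.
  elim: k => [|k IHk].
    rewrite (_ : subtorus_param _ z x = z) ?subrr ?normr0 ?divr1 ?subrr//.
    by apply/funext => j; rewrite /subtorus_param asboolF.
  have [_ _ _ /(_ z x)] := hs (ss k); rewrite size_ss => step.
  have {}step := step (fun hz => nz (ex_intro2 _ _ k I hz)).
  apply: (le_trans (ler_distD (f (subtorus_param [set` ss k] z x)) _ _)).
  apply: (le_trans (lerD step IHk)); rewrite le_eqVlt; apply/orP; left; apply/eqP.
  have t0 : (2 ^ k)%:R != 0 :> R by rewrite pnatr_eq0 -lt0n expn_gt0.
  by rewrite expnS natrM; field.
(* [resample set0] returns z itself, so [g z] fits the resampling lemmas. V collects the pairs with
   z good for which the infinite modification fails. *)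
pose V0 := [set w | d2 < `|g (resample A w) - g (resample set0 w)|].
pose V := (resample set0 @^-1` (~` Bad) `&` V0) `|` resample A @^-1` Z.
have [mAZ QAZ] := resampleZ0 A.
have mV0 : measurable V0 by exact: measurable_resample_far.
have mV1 : measurable (resample set0 @^-1` (~` Bad) `&` V0).
  by apply: measurableI => //; apply: measurable_resample_preimage; exact: measurableC.
have mV : measurable V by exact: measurableU.
have resample0 z x : resample set0 (z, x) = z.
  by apply/funext => j; rewrite /resample /subtorus_param asboolF.
(* Off null sets, a pair in V has its resampling along the finite stage B within d of z but the one
   along A farther than [2 * d]. Hence these two differ by more than d, an event of arbitrarily
   small measure. *)
have QV : Q V = 0%E.
  apply/eqP; rewrite eq_le measure_ge0 andbT; apply/lee_addgt0Pr => e e0.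
  rewrite add0e; have [N NQ] := resample_close QE mg d0 e0.
  pose B := [set` ss N].
  have [mBZ QBZ] := resampleZ0 B; have [m0Z Q0Z] := resampleZ0 set0.
  pose C := [set w | d < `|g (resample A w) - g (resample B w)|].
  pose D := resample B @^-1` Z `|` (resample set0 @^-1` Z `|` resample A @^-1` Z).
  have mC : measurable C by exact: measurable_resample_far.
  have m0A : measurable (resample set0 @^-1` Z `|` resample A @^-1` Z) by exact: measurableU.
  have mD : measurable D by exact: measurableU.
  have D0 : Q D = 0%E.
    by rewrite measureU0// measureU0.
  have VCD : V `<=` C `|` D.
    move=> [z x] [[nz Vzx]|AZ]; last by right; right; right.
    have [Dzx|/not_orP[nB /not_orP[n0 nA]]] := pselect (D (z, x)); first by right.
    left; rewrite /C /=; rewrite /V0 /= resample0 in Vzx.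
    rewrite /= resample0 in nz; rewrite /= resample0 in n0.
    have Bd : `|f (resample B (z, x)) - f z| <= d := osc z x N nz.
    rewrite (fg nB) (fg n0) in Bd.
    have := ler_distD (g (resample B (z, x))) (g (resample A (z, x))) (g z).
    rewrite /d in Bd *; lra.
  apply: (@le_trans _ _ (Q (C `|` D))).
    by apply: le_measure; rewrite ?inE//; exact: measurableU.
  apply: (le_trans (measureU2 _ mC mD)); rewrite [X in (_ + X)%E]D0 adde0.
  exact: NQ (Ass N).
have mx := measurable_fun_xsection P mV.
(* By Fubini, almost every section of V is null. *)
have [S [mS S0 VS]] : P.-negligible [set z | ~ P (xsection V z) = 0%E].
  have : ae_eq P setT (P \o xsection V) (cst 0%E).
    apply/(ae_eq_integral_abs P measurableT mx).
    rewrite -[RHS]QV; apply: eq_integral => z _ /=; by rewrite gee0_abs.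
  by apply: negligibleS => z /= nz; apply: contra_not nz; exact.
pose Big := [set x | K < `|g x|].
have mBig : measurable Big.
  have := @measurable_far _ _ _ g (fun=> 0) K mg (measurable_cst _).
  by under eq_set do rewrite subr0.
(* The bad sets have total mass at most 1/4 + 1/4 < 1. *)
have [z nz] : exists z, ~ ((Bad `|` Big) `|` (Z `|` S)) z.
  apply: contrapT => /forallNP H.
  have mBB : measurable (Bad `|` Big) by exact: measurableU.
  have mZS : measurable (Z `|` S) by exact: measurableU.
  have : (P setT <= P ((Bad `|` Big) `|` (Z `|` S)))%E.
    apply: le_measure; rewrite ?inE//; first exact: measurableU.
    by move=> z _; apply: contrapT; exact: H.
  rewrite probability_setT; apply/negP; rewrite -ltNge.
  apply: (le_lt_trans (measureU2 _ mBB mZS)); rewrite [X in (_ + X)%E]measureU0// [X in (_ + X)%E]Z0 adde0.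
  apply: (le_lt_trans (measureU2 _ mBad mBig)).
  apply: (le_lt_trans (leeD PBad PK)); rewrite -EFinD lte_fin; lra.
move: nz => /not_orP[/not_orP[nBad nBig] /not_orP[nZ nS]].
exists A, z, (f z); split => //.
  by rewrite (fg nZ) leNgt; apply/negP.
have zV0 : P (xsection V z) = 0%E by apply: contrapT => H; apply: nS; exact: VS.
exists (xsection V z); split => //; first exact: measurable_xsection.
move=> x /= /negP; rewrite -ltNge => fx; apply/xsectionP.
have [AZ|nA] := pselect (Z (resample A (z, x))); first by right.
left; split; first by rewrite /= resample0.
by rewrite /V0/= resample0 -(fg nA) -(fg nZ).
Qed.

End lipschitz.

(** * The limiting constant *)

Theorem theorem2 (R : realType) (p : \bar R) (hp : (1%:E < p)%E)
  (P : probability (Tinf R) R) (hP : is_uniform_product P)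
  (f : Tinf R -> R) (fmeas : completion_measurable_fun P f)
  (flip : exists L : R, 0 < L /\
     forall x y : nat -> R, ((`|f x - f y|)%:E <= L%:E * dist_p p x y)%E) :
  exists a : R, forall eps : R, 0 < eps ->
    exists (A : set nat) (b : nat -> R), infinite_set A /\
      (ess_sup P (fun x : Tinf R => (`|f (subtorus_param A b x) - a|)%:E)
        < eps%:E)%E.
Proof.
have [L [L0 fL]] := flip.
have [g [Z [mg mZ Z0 fg]]] := completion_measurable_ae fmeas.
have q0 : 0 < 1 / 4 :> R by lra.
(* K is fixed before the tolerance, so all values [c n] lie in one compact segment and have a
   cluster point. *)
have [K PK] := measurable_fun_tight (P := P) mg q0.
have /choice[c Hc] (n : nat) : exists c, `|c| <= K /\
    exists (A : set nat) (b : nat -> R), infinite_set A /\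
      {ae P, forall x, `|f (subtorus_param A b x) - c| <= n.+1%:R^-1}.
  have n0 : 0 < n.+1%:R^-1 :> R by rewrite invr_gt0.
  have [A [b [c [? ? ?]]]] := nearly_constant_subtorus hP hp L0 fL mg mZ Z0 fg PK n0.
  by exists c; split => //; exists A, b.
have [|a [_ ac]] := @segment_compact R (- K) K (c @ \oo) _.
  by exists 0%N => // n _ /=; rewrite in_itv/= -ler_norml; have [] := Hc n.
exists a => eps eps0.
have e20 : 0 < eps / 2 by lra.
(* Beyond N the tolerance [n.+1%:R^-1] is below eps / 2; the other half pays for the distance from
   [c n] to a. *)
pose N := Num.trunc (eps / 2)^-1.
have [_ [[n /= Nn <-] an]] :
    [set c n | n in [set n | (N <= n)%N]] `&` ball a (eps / 2) !=set0.
  apply: ac; last exact: nbhsx_ballx.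
  by exists N => // n Nn; exists n.
have neps : n.+1%:R^-1 < eps / 2.
  rewrite -[ltRHS]invrK ltf_pV2 ?posrE ?invr_gt0//.
  by rewrite (lt_le_trans (truncnS_gt _))// ler_nat ltnS.
have [_ [A [b [Ainf Ab]]]] := Hc n.
exists A, b; split => //.
apply: (@le_lt_trans _ _ (n.+1%:R^-1 + `|a - c n|)%:E).
  apply/ess_supP; apply: negligibleS Ab => x; apply: contra_not => xc; rewrite /= lee_fin.
  by rewrite (le_trans (ler_distD (c n) _ _))// lerD// distrC.
have acn : `|a - c n| < eps / 2 by move: an; rewrite -ball_normE.
by rewrite lte_fin [ltRHS]splitr ltrD.
Qed.
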